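(* Let $\mathcal T=(S,\Sigma,\kappa)$ be a stochastic transition system, $\mu\in\mathrm{Dist}(S)$ and $B\in\Sigma$. For $n\in\mathbb N$ let $$q_n^{\mathrm{Yes}}=\mathrm{Prob}^{\mathcal T}_\mu(\mathbf F_{\le n}\widetilde{\widetilde B}),\qquad q_n^{\mathrm{No}}=\mathrm{Prob}^{\mathcal T}_\mu(\mathbf F_{\le n}\widetilde B).$$ If $\mathcal T$ is persistently decisive w.r.t. $B$ from $\mu$ and decisive w.r.t. $\widetilde B$ from $\mu$, then the two sequences $(q_n^{\mathrm{Yes}})_n$ and $(1-q_n^{\mathrm{No}})_n$ are adjacent and converge to $\mathrm{Prob}^{\mathcal T}_\mu(\mathbf G\mathbf F B)$.
   Context: A stochastic transition system (STS) is $\mathcal T=(S,\Sigma,\kappa)$ where $(S,\Sigma)$ is a measurable space and $\kappa:S\times\Sigma\to[0,1]$ is a Markov kernel. $\mathrm{Dist}(S)$ is the set of probability measures on $(S,\Sigma)$; $\delta_s$ is the Dirac measure. For $\mu\in\mathrm{Dist}(S)$, $\mathrm{Prob}^{\mathcal T}_\mu$ is the law on infinite paths $s_0s_1\dots\in S^\omega$ (cylinder $\sigma$-algebra) of the Markov chain with initial distribution $\mu$ and kernel $\kappa$. Events: $\mathbf F B$: $\exists i\ge0,\ s_i\in B$; $\mathbf F_{\le n}B$: $\exists\,0\le i\le n,\ s_i\in B$; $\mathbf F_{\ge p}B$: $\exists i\ge p,\ s_i\in B$; $\mathbf G\mathbf F B$: $s_i\in B$ for infinitely many $i$. Avoid-set: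 $\widetilde B=\{s\in S\mid\mathrm{Prob}^{\mathcal T}_{\delta_s}(\mathbf F B)=0\}$ (it belongs to $\Sigma$); $\widetilde{\widetilde B}$ is the avoid-set of $\widetilde B$. $\mathcal T$ is decisive w.r.t. $B$ from $\mu$ if $\mathrm{Prob}^{\mathcal T}_\mu(\mathbf F B\vee\mathbf F\widetilde B)=1$; persistently decisive w.r.t. $B$ from $\mu$ if $\mathrm{Prob}^{\mathcal T}_\mu(\mathbf F_{\ge p}B\vee\mathbf F_{\ge p}\widetilde B)=1$ for every integer $p\ge0$. Two real sequences are adjacent if one is non-decreasing, the other is non-increasing, and their difference converges to $0$. *)

(* Defs.v *)
From HB Require Import structures.
From mathcomp Require Import all_boot all_order all_algebra.
From mathcomp Require Import all_classical all_reals all_analysis.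
From mathcomp Require Import measurable_realfun.
Set Implicit Arguments.
Unset Strict Implicit.
Unset Printing Implicit Defensive.
Import Order.TTheory GRing.Theory Num.Theory.
Import numFieldNormedType.Exports.
Local Open Scope classical_set_scope.
Local Open Scope ring_scope.
Local Open Scope ereal_scope.

(* Cyl(A_0, ..., A_n); only the first n+1 terms of the sequence A matter. *)
Definition cylinder (S : Type) (n : nat) (A : nat -> set S) : set (nat -> S) :=
  [set w | forall i, (i <= n)%N -> A i (w i)].

Definition cylinders d (S : measurableType d) : set (set (nat -> S)) :=
  [set C | exists n A, (forall i, measurable (A i)) /\ C = cylinder n A].

(* S^omega with the sigma-algebra generated by the cylinders. *)
Notation paths S := (g_sigma_algebraType (@cylinders _ S)).

(* int_{A_0} m(ds_0) int_{A_1} kappa(s_0, ds_1) ... int_{A_n} kappa(s_{n-1}, ds_n),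
   by recursion on n: after the first step the chain restarts from kappa s_0. *)
Fixpoint cylinder_prob d (S : measurableType d) (R : realType)
    (kappa : R.-pker S ~> S) (n : nat) (A : nat -> set S)
    (m : {measure set S -> \bar R}) : \bar R :=
  if n is n'.+1 then
    \int[m]_(s in A 0%N) cylinder_prob kappa n' (fun i => A i.+1) (kappa s)
  else m (A 0%N).

(* The law on S^omega of the Markov chain with initial distribution mu and
   kernel kappa. It exists (ionescu_tulcea) and is unique (path_law_unique). *)
Definition is_path_law d (S : measurableType d) (R : realType)
    (kappa : R.-pker S ~> S) (mu : probability S R)
    (P : probability (paths S) R) : Prop :=
  forall n (A : nat -> set S), (forall i, measurable (A i)) ->
    P (cylinder n A) = cylinder_prob kappa n A mu.

(* Existence of the law, for an arbitrary measurable space S. Finite-horizon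
   probabilities define a content on the algebra of measurable sets of paths
   that depend on finitely many coordinates; the content is continuous at set0
   (init_prob_continuous0), hence sigma-additive, and Caratheodory's extension
   applies. *)
Section ionescu_tulcea.
Context d (S : measurableType d) (R : realType) (kappa : R.-pker S ~> S).
Implicit Types (A B : set (paths S)) (s t : S) (w : paths S).

Definition pcons s w : paths S := fun i => if i is j.+1 then w j else s.

Definition psec A s : set (paths S) := [set w | A (pcons s w)].

(* Probability of A when s_0 = s, s_1, ..., s_n follow the chain and the path is
   then frozen at s_n: exact as soon as A depends only on the coordinates up
   to n. *)
Fixpoint step_prob n A s : \bar R :=
  if n is n'.+1 then \int[kappa s]_t step_prob n' (psec A s) t
  else (\1_A (cst s : paths S))%:E.

Lemma measurable_coord i : measurable_fun [set: paths S] (fun w => w i).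
Proof.
move=> _ U mU; rewrite setTI; apply: sub_sigma_algebra => /=.
exists i, (fun j => if j == i then U else setT); split.
  by move=> j; case: ifP.
apply/seteqP; split => w /=; first by move=> Uw j _; case: eqP => // ->.
by move=> /(_ i (leqnn _)); rewrite eqxx.
Qed.

Lemma measurable_to_paths d' (X : measurableType d') (f : X -> paths S) :
  (forall i, measurable_fun [set: X] (fun x => f x i)) ->
  measurable_fun [set: X] f.
Proof.
move=> mf; apply: (@measurability _ _ _ (paths S) _ _ (@cylinders d S)) => //.
move=> _ [C [n [A [mA ->]]] <-].
have -> : [set: X] `&` f @^-1` cylinder n A =
    \bigcap_(i in [set j | (j <= n)%N]) ((fun x => f x i) @^-1` A i).
  by rewrite setTI.
apply: bigcap_measurableType => i _; rewrite -[X in measurable X]setTI.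
exact: mf.
Qed.

Lemma measurable_pcons d' (X : measurableType d') (f : X -> S)
    (g : X -> paths S) : measurable_fun [set: X] f ->
  measurable_fun [set: X] g ->
  measurable_fun [set: X] (fun x => pcons (f x) (g x)).
Proof.
move=> mf mg; apply: measurable_to_paths => -[|i] //=.
exact: (measurableT_comp (measurable_coord i)).
Qed.

Lemma measurable_psec A s : measurable A -> measurable (psec A s).
Proof.
move=> mA; rewrite -[X in measurable X]setTI.
by apply: (measurable_pcons (measurable_cst s) (@measurable_id _ _ setT)).
Qed.

Lemma step_prob_ge0 n A s : 0 <= step_prob n A s.
Proof.
elim: n A s => [|n ih] A s /=; first by rewrite lee_fin.
exact: integral_ge0.
Qed.

Lemma measurable_step_prob_param n d' (X : measurableType d')
    (C : set (X * paths S)) : measurable C ->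
  measurable_fun [set: X * S]
    (fun z : X * S => step_prob n (xsection C z.1) z.2).
Proof.
elim: n d' X C => [|n ih] d' X C mC /=.
  apply/measurable_EFinP.
  rewrite (_ : (fun _ => _) = \1_C \o (fun z : X * S => (z.1, cst z.2 : paths S))).
    apply: measurableT_comp; first exact: measurable_indic.
    apply: measurable_fun_pair => //; apply: measurable_to_paths => i.
    exact: measurable_snd.
  by apply/funext => z /=; rewrite !indicE mem_xsection.
pose g (z : (X * S) * paths S) := (z.1.1, pcons z.1.2 z.2).
have mg : measurable_fun [set: _] g.
  apply: measurable_fun_pair; first exact: measurableT_comp.
  by apply: measurable_pcons => //; exact: measurableT_comp.
have mC' : measurable (g @^-1` C) by rewrite -[X in measurable X]setTI; exact: mg.
exact: (measurable_fun_integral_finite_kernel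
  (fun z : (X * S) * S => step_prob n (xsection (g @^-1` C) z.1) z.2)
  (@kernel.kernel_snd _ _ _ X S S R kappa)
  (fun=> step_prob_ge0 _ _ _) (ih _ _ _ mC')).
Qed.

Lemma measurable_step_prob n A : measurable A ->
  measurable_fun [set: S] (step_prob n A).
Proof.
move=> mA; have mC : measurable ([set: S] `*` A) by exact: measurableX.
have := measurableT_comp (measurable_step_prob_param n mC)
  (measurable_fun_pair (@measurable_id _ S setT) (@measurable_id _ S setT)).
congr (measurable_fun _ _); apply/funext => s /=.
by rewrite xsectionE setTX /=; congr step_prob; apply/seteqP; split => w.
Qed.

Lemma step_prob0 n s : step_prob n set0 s = 0.
Proof.
elim: n s => [|n ih] s /=; first by rewrite indic0.
by under eq_integral do rewrite ih; rewrite integral0.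
Qed.

Lemma step_probT n s : step_prob n setT s = 1.
Proof.
elim: n s => [|n ih] s /=; first by rewrite indicT.
under eq_integral do rewrite (_ : psec setT s = setT)// ih.
by rewrite integral_cst// mul1e prob_kernel.
Qed.

Lemma psecU A B s : psec (A `|` B) s = psec A s `|` psec B s.
Proof. by []. Qed.

Lemma psecI A B s : psec (A `&` B) s = psec A s `&` psec B s.
Proof. by []. Qed.

Lemma step_probU n A B s : measurable A -> measurable B -> A `&` B = set0 ->
  step_prob n (A `|` B) s = step_prob n A s + step_prob n B s.
Proof.
elim: n A B s => [|n ih] A B s mA mB AB /=.
  rewrite -EFinD !indicE in_setU; congr EFin.
  have : ~~ ((cst s \in A) && (cst s \in B)) by rewrite -in_setI AB in_set0.
  by case: (_ \in A) (_ \in B) => -[]//= _; rewrite ?addr0 ?add0r.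
have mJ (C : set (paths S)) : measurable C -> measurable_fun setT (step_prob n (psec C s)).
  move=> mC. apply: measurable_step_prob; exact: measurable_psec.
have J0 (C : set (paths S)) t : setT t -> 0 <= step_prob n (psec C s) t.
  by move=> _; exact: step_prob_ge0.
rewrite -(ge0_integralD _ measurableT (J0 A) (mJ A mA) (J0 B) (mJ B mB)).
apply: eq_integral => t _; rewrite psecU ih//; try exact: measurable_psec.
by rewrite -psecI AB.
Qed.

Lemma le_step_prob n A B s : measurable A -> measurable B -> A `<=` B ->
  step_prob n A s <= step_prob n B s.
Proof.
move=> mA mB AB; rewrite -(setDUK AB) step_probU//.
- by rewrite leeDl// step_prob_ge0.
- exact: measurableD.
- by rewrite setDE setIC -setIA setICl setI0.
Qed.

Lemma step_prob_le1 n A s : measurable A -> step_prob n A s <= 1.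
Proof. by move=> mA; rewrite -(step_probT n s) le_step_prob. Qed.

Definition determined n A :=
  forall w w', (forall i, (i <= n)%N -> w i = w' i) -> A w -> A w'.

Lemma determined_psec n A s : determined n.+1 A -> determined n (psec A s).
Proof. by move=> dA w w' ww'; apply: dA => -[|i]//=; exact: ww'. Qed.

Lemma determinedW n m A : (n <= m)%N -> determined n A -> determined m A.
Proof.
by move=> nm dA w w' ww'; apply: dA => i ni; apply: ww'; exact: leq_trans nm.
Qed.

Lemma determinedU n A B : determined n A -> determined n B ->
  determined n (A `|` B).
Proof.
move=> dA dB w w' ww' [Aw|Bw]; first by left; exact: dA Aw.
by right; exact: dB Bw.
Qed.

Lemma determinedC n A : determined n A -> determined n (~` A).
Proof.
move=> dA w w' ww' Aw Aw'; apply/Aw/(dA w') => // i ni.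
by rewrite ww'.
Qed.

Lemma step_probS n A s : determined n A ->
  step_prob n.+1 A s = step_prob n A s.
Proof.
elim: n A s => [|n ih] A s dA.
  rewrite /=; under eq_integral => t _.
    rewrite (_ : \1_(psec A s) (cst t) = \1_A (cst s))%R; first over.
    rewrite !indicE; congr (_%:R); congr nat_of_bool.
    apply/idP/idP; rewrite !inE; apply: dA => -[|//] //.
  by rewrite integral_cst// prob_kernel mule1.
change (\int[kappa s]_t step_prob n.+1 (psec A s) t =
  \int[kappa s]_t step_prob n (psec A s) t).
by apply: eq_integral => t _; apply: ih; exact: determined_psec.
Qed.

Lemma step_prob_stable n m A s : determined n A -> (n <= m)%N ->
  step_prob m A s = step_prob n A s.
Proof.
move=> dA nm; rewrite -(subnK nm); elim: (m - n)%N => // k ih.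
by rewrite addSn step_probS//; apply: determinedW dA; exact: leq_addl.
Qed.

Definition det_sets : set (set (paths S)) :=
  [set A | measurable A /\ exists n, determined n A].

Definition chain_prob A s : \bar R :=
  step_prob (xget 0%N [set n | determined n A]) A s.

Lemma chain_probE n A s : determined n A -> chain_prob A s = step_prob n A s.
Proof.
move=> dA; rewrite /chain_prob; set m := xget _ _.
have dA' : determined m A by apply: (@xgetPex _ 0%N [set n | determined n A]); exists n.
rewrite -(step_prob_stable s dA (leq_maxl n m)).
by rewrite (step_prob_stable s dA' (leq_maxr n m)).
Qed.

Lemma det_sets_common A B : det_sets A -> det_sets B ->
  exists n, determined n A /\ determined n B.
Proof.
move=> [_ [n dA]] [_ [m dB]]; exists (maxn n m); split.
  by apply: determinedW dA; rewrite leq_maxl.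
by apply: determinedW dB; rewrite leq_maxr.
Qed.

Lemma det_sets0 : det_sets set0.
Proof. by split => //; exists 0%N. Qed.

Lemma det_setsT : det_sets setT.
Proof. by split => //; exists 0%N. Qed.

Lemma det_setsU : setU_closed det_sets.
Proof.
move=> A B sA sB; have [n [dA dB]] := det_sets_common sA sB.
split; first exact: (measurableU _ _ sA.1 sB.1).
by exists n; exact: determinedU.
Qed.

Lemma det_setsC : setC_closed det_sets.
Proof.
move=> A [mA [n dA]]; split; first exact: measurableC.
by exists n; exact: determinedC.
Qed.

Lemma det_sets_psec A s : det_sets A -> det_sets (psec A s).
Proof.
move=> [mA [n dA]]; split; first exact: measurable_psec.
by exists n; apply: determined_psec; apply: determinedW dA.
Qed.

Lemma chain_probU A B s : det_sets A -> det_sets B -> A `&` B = set0 ->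
  chain_prob (A `|` B) s = chain_prob A s + chain_prob B s.
Proof.
move=> sA sB AB; have [n [dA dB]] := det_sets_common sA sB.
by rewrite !(@chain_probE n)//; [exact: step_probU sA.1 sB.1 _|exact: determinedU].
Qed.

Lemma chain_prob_ge0 A s : 0 <= chain_prob A s.
Proof. exact: step_prob_ge0. Qed.

Lemma chain_prob_le1 A s : det_sets A -> chain_prob A s <= 1.
Proof. by move=> [mA [n dA]]; rewrite (chain_probE _ dA) step_prob_le1. Qed.

Lemma le_chain_prob A B s : det_sets A -> det_sets B -> A `<=` B ->
  chain_prob A s <= chain_prob B s.
Proof.
move=> sA sB AB; have [n [dA dB]] := det_sets_common sA sB.
by rewrite !(@chain_probE n)//; apply: le_step_prob => //; [case: sA|case: sB].
Qed.

Lemma measurable_chain_prob A : det_sets A ->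
  measurable_fun [set: S] (chain_prob A).
Proof.
move=> [mA [n dA]]; rewrite (_ : chain_prob A = step_prob n A).
  exact: measurable_step_prob.
by apply/funext => s; exact: chain_probE.
Qed.

Lemma chain_prob_psec A s : det_sets A ->
  chain_prob A s = \int[kappa s]_t chain_prob (psec A s) t.
Proof.
move=> [mA [n dA]].
rewrite (@chain_probE n.+1); last exact: determinedW dA.
apply: eq_integral => t _; rewrite (@chain_probE n)//.
by apply: determined_psec; exact: determinedW dA.
Qed.

Definition init_prob (m : {measure set S -> \bar R}) A : \bar R :=
  \int[m]_s chain_prob A s.

Lemma init_prob_cvg0 (m : {measure set S -> \bar R})
    (B : nat -> set (paths S)) : m setT = 1 ->
  (forall k, det_sets (B k)) ->
  (forall t, chain_prob (B k) t @[k --> \oo] --> 0) ->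
  init_prob m (B k) @[k --> \oo] --> 0.
Proof.
move=> m1 sB B0.
have [|||||] := @dominated_convergence _ S R m setT measurableT
  (fun k => chain_prob (B k)) (cst 0) (cst 1).
- by move=> k; exact: measurable_chain_prob.
- exact: measurable_cst.
- by apply: aeW => t _; exact: B0.
- apply/integrableP; split; first exact: measurable_cst.
  under eq_integral do rewrite /= normr1.
  by rewrite integral_cst// m1 mule1 ltry.
- apply: aeW => t k _; rewrite gee0_abs; first exact: chain_prob_le1.
  exact: chain_prob_ge0.
- by move=> _ _; rewrite integral0.
Qed.

Definition good (x : (nat -> set (paths S)) * S) :=
  (forall k, det_sets (x.1 k)) /\
  ~ (chain_prob (x.1 k) x.2 @[k --> \oo] --> 0).

Lemma good_next x : good x ->
  exists t, good (fun k => psec (x.1 k) x.2, t).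
Proof.
case: x => B s [sB nB] /=; apply: contrapT => /forallNP no.
apply: nB => /=.
have sB' k : det_sets (psec (B k) s) by exact: det_sets_psec.
have -> : (fun k => chain_prob (B k) s) =
    (fun k => init_prob (kappa s) (psec (B k) s)).
  by apply/funext => k; rewrite chain_prob_psec.
apply: (@init_prob_cvg0 (kappa s) (fun k => psec (B k) s) (prob_kernel s)) => // t.
by apply: contrapT => nt; apply: (no t).
Qed.

Lemma init_prob_continuous0 (m : probability S R) (B : nat -> set (paths S)) :
  (forall k, det_sets (B k)) ->
  (forall j k, (j <= k)%N -> B k `<=` B j) ->
  \bigcap_k B k = set0 ->
  init_prob m (B k) @[k --> \oo] --> 0.
Proof.
move=> sB ndB B0; apply: init_prob_cvg0 => [|//|t].
  exact: probability_setT.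
apply: contrapT => nB.
have [f fP] : {f : (nat -> set (paths S)) * S -> (nat -> set (paths S)) * S &
    forall x, good x -> good (f x) /\ (f x).1 = (fun k => psec (x.1 k) x.2)}.
  apply: (@choice _ _ (fun x y => good x ->
    good y /\ y.1 = (fun k => psec (x.1 k) x.2))) => x.
  have [/good_next[u gu]|?] := pselect (good x); last by exists x.
  by exists (fun k => psec (x.1 k) x.2, u).
pose x n := iter n f (B, t).
have gx n : good (x n) by elim: n => [//|n /fP[]].
have x1 n : (x n.+1).1 = (fun k => psec ((x n).1 k) (x n).2).
  by have [] := fP _ (gx n).
pose w : paths S := fun n => (x n).2.
pose shift n : paths S := fun i => w (n + i)%N.
have pshift n : pcons (w n) (shift n.+1) = shift n.
  by apply/funext => -[|i] /=; rewrite /shift ?addn0// addSnnS.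
have xw n k : (x n).1 k (shift n) = B k w.
  elim: n => [//|n ih]; rewrite x1 -ih /psec /=; congr ((x n).1 k _).
  exact: pshift.
have ndx n j k : (j <= k)%N -> (x n).1 k `<=` (x n).1 j.
  elim: n => [|n ih] jk; first exact: ndB.
  by rewrite x1 => v; exact: ih.
have dx n N k : determined (n + N) (B k) -> determined N ((x n).1 k).
  elim: n N => [//|n ih] N dB; rewrite x1; apply: determined_psec.
  by apply: ih; rewrite addnS.
suff : (\bigcap_k B k) w by rewrite B0.
move=> k0 _; apply: contrapT => nBw.
have [_ [N dB]] := sB k0.
have dxN : determined 0 ((x N).1 k0) by apply: dx; rewrite addn0.
have c0 : chain_prob ((x N).1 k0) (x N).2 = 0.
  rewrite (chain_probE _ dxN) /= indicE; case: (boolP (_ \in _)) => //.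
  rewrite inE => xk0; exfalso; apply: nBw; rewrite -(xw N).
  by apply: dxN xk0 => -[|//] _; rewrite /shift addn0.
have [sx] := gx N; apply.
apply: cvg_near_cst; near=> k.
apply/eqP; rewrite eq_le chain_prob_ge0 andbT -c0.
apply: le_chain_prob => //; apply: ndx.
by near: k; exists k0.
Unshelve. all: by end_near. Qed.

Lemma init_prob_ge0 (m : {measure set S -> \bar R}) A : 0 <= init_prob m A.
Proof. by apply: integral_ge0 => s _; exact: chain_prob_ge0. Qed.

Lemma init_prob0 (m : {measure set S -> \bar R}) : init_prob m set0 = 0.
Proof. by rewrite /init_prob integral0_eq// => s _; exact: step_prob0. Qed.

Lemma init_probT (m : probability S R) : init_prob m setT = 1.
Proof.
rewrite /init_prob; under eq_integral do rewrite /chain_prob step_probT.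
rewrite integral_cst// mul1e; exact: probability_setT.
Qed.

Lemma init_probU (m : {measure set S -> \bar R}) A B :
  det_sets A -> det_sets B -> A `&` B = set0 ->
  init_prob m (A `|` B) = init_prob m A + init_prob m B.
Proof.
move=> sA sB AB; rewrite /init_prob.
rewrite -(ge0_integralD _ measurableT (fun s _ => chain_prob_ge0 A s)
  (measurable_chain_prob sA) (fun s _ => chain_prob_ge0 B s)
  (measurable_chain_prob sB)).
by apply: eq_integral => s _; exact: chain_probU.
Qed.

Lemma init_prob_fin (m : probability S R) A : det_sets A ->
  init_prob m A \is a fin_num.
Proof.
move=> sA; rewrite ge0_fin_numE ?init_prob_ge0//.
have := init_probU m sA (det_setsC sA) (setICr A).
rewrite setUCr init_probT => e.
by rewrite (@le_lt_trans _ _ 1) ?ltry// e leeDl// init_prob_ge0.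
Qed.

End ionescu_tulcea.

(* Alias of S^omega carrying the algebra det_sets instead of the sigma-algebra. *)
Definition det_algebra d (S : measurableType d) : Type := nat -> S.

HB.instance Definition _ d (S : measurableType d) := Pointed.on (det_algebra S).
HB.instance Definition _ d (S : measurableType d) :=
  isAlgebraOfSets.Build default_measure_display (det_algebra S)
    (@det_sets0 d S) (@det_setsU d S) (@det_setsC d S).

Section path_law.
Context d (S : measurableType d) (R : realType) (kappa : R.-pker S ~> S).
Variable m : probability S R.

Definition path_content (A : set (det_algebra S)) := init_prob kappa m A.

Let path_content0 : path_content set0 = 0. Proof. exact: init_prob0. Qed.

Let path_content_ge0 A : 0 <= path_content A.
Proof. exact: init_prob_ge0. Qed.

Let path_content_sigma_additive : semi_sigma_additive path_content.
Proof.
move=> F mF tF mV; set V := \bigcup_n F n in mV *.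
pose U n : set (det_algebra S) := \big[setU/set0]_(i < n) F i.
have mU n : measurable (U n) by exact: bigsetU_measurable.
have UF n : U n `&` F n = set0.
  rewrite -subset0 /U -bigcup_mkord => w [[i /= ni Fi] Fn].
  by have := tF i n I I (ex_intro _ w (conj Fi Fn)) => e; move: ni; rewrite e ltnn.
have sumU n : \sum_(0 <= i < n) path_content (F i) = path_content (U n).
  elim: n => [|n ih]; first by rewrite big_nil /U big_ord0 path_content0.
  rewrite big_nat_recr//= ih /U big_ord_recr/=; apply/esym.
  exact: (init_probU kappa m (mU n) (mF n) (UF n)).
have UV n : U n `<=` V.
  by rewrite /U -bigcup_mkord => w [i _ Fi]; exists i.
have mD n : measurable (V `\` U n) by exact: measurableD.
have eU n : path_content (U n) = path_content V - path_content (V `\` U n).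
  rewrite -[in path_content V](setDUK (UV n)) /path_content.
  rewrite (init_probU kappa m (mU n) (mD n)).
    by rewrite addeK//; exact: (init_prob_fin kappa m (mD n)).
  by rewrite setDE setICA setICr setI0.
under eq_fun do rewrite sumU eU.
suff D0 : path_content (V `\` U n) @[n --> \oo] --> 0.
  have := cvgeB _ (cvg_cst (path_content V)) D0.
  by rewrite sube0; apply; rewrite fin_num_adde_defl.
apply: (@init_prob_continuous0 _ S R kappa m (fun n => V `\` U n)) => //.
- move=> j k jk w [Vw nUw]; split => // Ujw; apply: nUw.
  move: Ujw; rewrite /U -!bigcup_mkord => -[i /= ij Fi]; exists i => //=.
  exact: leq_trans jk.
- rewrite -subset0 => w VU; have [[i _ Fi] _] := VU 0%N I.
  have [_] := VU i.+1 I; apply; rewrite /U -bigcup_mkord.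
  by exists i => /=.
Qed.

HB.instance Definition _ := isMeasure.Build default_measure_display
  (det_algebra S) R path_content
  path_content0 path_content_ge0 path_content_sigma_additive.

Lemma measurable_path_id : measurable_fun
  [set: g_sigma_algebraType (@measurable _ (det_algebra S))]
  (id : _ -> paths S).
Proof.
apply: measurable_to_paths => i _ U mU; rewrite setTI; apply: sub_sigma_algebra.
split; first by rewrite -[X in measurable X]setTI; exact: measurable_coord.
by exists i => w w' /(_ i (leqnn i)) /= ->.
Qed.


Definition path_measure (A : set (paths S)) : \bar R :=
  measure_extension path_content A.

Let path_measure0 : path_measure set0 = 0.
Proof. exact: (measure0 (measure_extension path_content)). Qed.

Let path_measure_ge0 A : 0 <= path_measure A.
Proof. exact: (measure_ge0 (measure_extension path_content)). Qed.

Let path_measure_sigma_additive : semi_sigma_additive path_measure.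
Proof.
move=> F mF tF mV.
have mI (A : set (paths S)) : measurable A ->
    measurable (A : set (g_sigma_algebraType (@measurable _ (det_algebra S)))).
  by move=> mA; rewrite -[X in measurable X]setTI; exact: measurable_path_id.
apply: (@measure_semi_sigma_additive _ _ _ (measure_extension path_content)).
- by move=> n; exact: mI.
- exact: tF.
- exact: mI.
Qed.

HB.instance Definition _ := isMeasure.Build _ _ _ path_measure
  path_measure0 path_measure_ge0 path_measure_sigma_additive.

Lemma path_measureE A : det_sets A -> path_measure A = init_prob kappa m A.
Proof.
move=> sA; by rewrite /path_measure /measure_extension/= measurable_mu_extE.
Qed.

Let path_measure_setT : path_measure setT = 1.
Proof. by rewrite path_measureE; [exact: init_probT|exact: det_setsT]. Qed.

HB.instance Definition _ :=
  Measure_isProbability.Build _ _ _ path_measure path_measure_setT.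

Lemma measurable_cylinder n (A : nat -> set S) :
  (forall i, measurable (A i)) -> measurable (cylinder n A : set (paths S)).
Proof. by move=> mA; apply: sub_sigma_algebra; exists n, A. Qed.

Lemma determined_cylinder n (A : nat -> set S) :
  determined n (cylinder n A : set (paths S)).
Proof. by move=> w w' ww' Aw i ni; rewrite -ww'//; exact: Aw. Qed.

Lemma psec_cylinder n (A : nat -> set S) s :
  psec (cylinder n.+1 A) s = (if s \in A 0%N then cylinder n (fun i => A i.+1)
                              else set0) :> set (paths S).
Proof.
case: ifPn; rewrite ?notin_setE ?inE => As; apply/seteqP; split => w //=.
- by move=> Aw i ni; exact: (Aw i.+1).
- by move=> Aw [//|i] ni; exact: Aw.
- by move=> Aw; apply: As; exact: (Aw 0%N).
Qed.

Lemma integral_step_prob_cylinder (l : {measure set S -> \bar R}) n A :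
  (forall i, measurable (A i)) ->
  \int[l]_s step_prob kappa n (cylinder n A) s = cylinder_prob kappa n A l.
Proof.
elim: n A l => [|n ih] A l mA /=.
  rewrite -(setIT (A 0%N)) -integral_indic//; apply: eq_integral => s _.
  rewrite !indicE; congr (_%:R%:E); congr nat_of_bool.
  apply/idP/idP; rewrite !inE => As; first exact: As.
  by move=> i; rewrite leqn0 => /eqP ->.
rewrite [RHS]integral_mkcond; apply: eq_integral => s _.
rewrite psec_cylinder /patch; case: ifPn => // _.
- by apply: ih.
- by rewrite integral0_eq// => t _; exact: step_prob0.
Qed.

Lemma path_measureP : is_path_law kappa m path_measure.
Proof.
move=> n A mA /=.
rewrite path_measureE; last first.
  by split; [exact: measurable_cylinder|exists n; exact: determined_cylinder].
rewrite -integral_step_prob_cylinder//; apply: eq_integral => s _.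
by rewrite (chain_probE kappa _ (@determined_cylinder n A)).
Qed.

Theorem ionescu_tulcea : exists P : probability (paths S) R,
  is_path_law kappa m P.
Proof. by exists path_measure; exact: path_measureP. Qed.

Definition path_law : probability (paths S) R := projT1 (cid ionescu_tulcea).

Lemma path_lawP : is_path_law kappa m path_law.
Proof. exact: projT2 (cid ionescu_tulcea). Qed.

Lemma path_law_unique (P : probability (paths S) R) : is_path_law kappa m P ->
  forall A, measurable A -> P A = path_law A.
Proof.
move=> mP A mA.
apply: (@measure_unique _ _ (paths S) (@cylinders d S) (fun=> setT)) => //.
- move=> _ _ [n [A1 [mA1 ->]]] [k [A2 [mA2 ->]]].
  exists (maxn n k), (fun i => (if (i <= n)%N then A1 i else setT) `&`
    (if (i <= k)%N then A2 i else setT)); split.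
    by move=> i; apply: measurableI; case: ifP.
  apply/seteqP; split => w /=.
    move=> [w1 w2] i _; split; case: ifP => // h.
      exact: w1.
    exact: w2.
  move=> w12; split => i ni.
    by have [] := w12 i (leq_trans ni (leq_maxl _ _)); rewrite ni.
  by have [] := w12 i (leq_trans ni (leq_maxr _ _)); rewrite ni.
- by move=> _; exists 0%N, (fun=> setT); split=> //; apply/seteqP; split.
- by rewrite bigcup_const//; exists 0%N.
- by move=> _ [n [A1 [mA1 ->]]]; apply: (etrans (mP n A1 mA1)); apply/esym; exact: path_lawP.
- by move=> _; apply: (@le_lt_trans _ _ 1); [exact: probability_le1|exact: ltry].
Qed.

Lemma path_lawE A : det_sets A -> path_law A = init_prob kappa m A.
Proof.
move=> sA; rewrite -(path_law_unique path_measureP sA.1).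
exact: path_measureE.
Qed.

End path_law.

Section events.
Context d (S : measurableType d).
Implicit Types (B : set S) (n p : nat).

Definition eventually_in B : set (paths S) := [set w | exists i, B (w i)].

Definition within_in n B : set (paths S) :=
  [set w | exists i, (i <= n)%N /\ B (w i)].

Definition after_in p B : set (paths S) :=
  [set w | exists i, (p <= i)%N /\ B (w i)].

Definition infinitely_often_in B : set (paths S) :=
  [set w | infinite_set [set i | B (w i)]].

Lemma det_sets_within_in n B : measurable B -> det_sets (within_in n B).
Proof.
move=> mB; split; last first.
  exists n => w w' ww' [i [ni Bi]]; exists i; split => //.
  by rewrite -ww'.
have -> : within_in n B = \bigcup_(i in [set j | (j <= n)%N])
    ((fun w : paths S => w i) @^-1` B).
  by apply/seteqP; split => w [i]; [case|] => ni Bi; exists i.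
apply: bigcup_measurable => i _; rewrite -[X in measurable X]setTI.
exact: measurable_coord.
Qed.

Lemma eventually_inE B : eventually_in B = \bigcup_n within_in n B.
Proof.
apply/seteqP; split => w [i]; first by exists i => //; exists i.
by move=> _ [j [_ Bj]]; exists j.
Qed.

End events.

Section decisiveness.
Context d (S : measurableType d) (R : realType) (kappa : R.-pker S ~> S).

Definition avoid (B : set S) : set S :=
  [set s | path_law kappa (dirac s) (eventually_in B) = 0].

Definition decisive (B : set S) (mu : probability S R) : Prop :=
  path_law kappa mu (eventually_in B `|` eventually_in (avoid B)) = 1.

Definition persistently_decisive (B : set S) (mu : probability S R) : Prop :=
  forall p, path_law kappa mu (after_in p B `|` after_in p (avoid B)) = 1.

Lemma measurable_avoid (B : set S) : measurable B -> measurable (avoid B).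
Proof.
move=> mB; pose W n : set (paths S) := within_in n B.
have sW n : det_sets (W n) by exact: det_sets_within_in.
have mW n : measurable (W n) by have [] := sW n.
have -> : avoid B = \bigcap_n [set s | chain_prob kappa (W n) s = 0].
  have lawE n s : path_law kappa (dirac s) (W n) = chain_prob kappa (W n) s.
    rewrite path_lawE// /init_prob integral_dirac//.
      by rewrite diracT mul1e.
    exact: measurable_chain_prob.
  apply/seteqP; split => s /=.
    rewrite /avoid /= eventually_inE => W0 n _ /=; rewrite -lawE.
    apply: subset_measure0 W0 => //; first exact: bigcupT_measurable.
    exact: bigcup_sup.
  move=> W0; rewrite /avoid /= eventually_inE.
  apply/eqP; rewrite eq_le measure_ge0 andbT.
  have := measure_sigma_subadditive (path_law kappa (dirac s)) mW
    (bigcupT_measurable _ mW) (@subset_refl _ _).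
  by rewrite eseries0// => n _ _; rewrite /= lawE; exact: W0.
apply: bigcap_measurableType => n _; rewrite -[X in measurable X]setTI.
exact: (measurable_chain_prob kappa (sW n) measurableT (emeasurable_set1 0)).
Qed.

End decisiveness.

Definition adjacent_seqs (R : realType) (u v : nat -> R) : Prop :=
  ((nondecreasing_seq u /\ nonincreasing_seq v) \/
   (nonincreasing_seq u /\ nondecreasing_seq v)) /\
  ((u n - v n)%R @[n --> \oo] --> (0 : R)%R).

(* Main.v *)
Require Import Defs.
From HB Require Import structures.
From mathcomp Require Import all_boot all_order all_algebra.
From mathcomp Require Import all_classical all_reals all_analysis.
From mathcomp Require Import measurable_realfun.
Import Order.TTheory GRing.Theory Num.Theory.
Import numFieldNormedType.Exports.
Local Open Scope classical_set_scope.
Local Open Scope ring_scope.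

(* By the Markov property at each fixed time, almost no path visits [avoid D]
   and later visits D.
   With D = B, GF B and F (avoid B) are almost surely disjoint, and persistent
   decisiveness makes one of them occur.
   With D = avoid B, a path visiting avoid (avoid B) at time j almost surely
   never visits avoid B from j on; if it had visited avoid B before, it would
   not visit B from j on either, against persistent decisiveness. So F (avoid B)
   and F (avoid (avoid B)) are almost surely disjoint as well, and decisiveness
   makes one of them occur. Both GF B and F (avoid (avoid B)) are therefore
   almost surely the complement of F (avoid B). *)

Section path_events.
Local Set Implicit Arguments.
Local Unset Strict Implicit.
Context {d : measure_display} {S : measurableType d}.
Implicit Types (D : set S) (i k n p : nat).

Lemma det_sets_coord i D : measurable D ->
  det_sets ((fun w : paths S => w i) @^-1` D).
Proof.
move=> mD; split; first by rewrite -[X in measurable X]setTI; exact: measurable_coord.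
by exists i => w w' /(_ i (leqnn i)) /= ->.
Qed.

Lemma measurable_eventually_in D : measurable D ->
  measurable (eventually_in D : set (paths S)).
Proof.
move=> mD; rewrite eventually_inE; apply: bigcupT_measurable => n.
by have [] := det_sets_within_in n mD.
Qed.

Lemma measurable_after_in p D : measurable D ->
  measurable (after_in p D : set (paths S)).
Proof.
move=> mD; rewrite (_ : after_in p D = \bigcup_(i in [set j | (p <= j)%N])
    ((fun w : paths S => w i) @^-1` D)).
  by apply: bigcup_measurable => i _; have [] := det_sets_coord i mD.
by apply/seteqP; split => w [i]; [case|] => pi Di; exists i.
Qed.

Lemma infinitely_often_inE D :
  infinitely_often_in D = \bigcap_p (after_in p D : set (paths S)).
Proof.
apply/seteqP; split => w /=.
  move=> infD p _.
  have /infinite_setN0[i [Di /negP]] := infinite_setD infD (finite_II p).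
  by rewrite -leqNgt => pi; exists i.
move=> Dw /finite_seqP[s sE].
(* If the visit times formed a finite list [s], a visit later than the maximum of [s] would be a
   time missing from it. *)
have [i [si Di]] := Dw (\max_(j <- s) j).+1 I.
have : i \in s by have : [set` s] i by rewrite -sE.
by move=> /(@leq_bigmax_seq _ s xpredT id)/(_ isT)/(leq_trans si); rewrite ltnn.
Qed.

Lemma measurable_infinitely_often_in D : measurable D ->
  measurable (infinitely_often_in D : set (paths S)).
Proof.
move=> mD; rewrite infinitely_often_inE.
by apply: bigcapT_measurable => p; exact: measurable_after_in.
Qed.

Lemma le_within_in n p D : (n <= p)%N ->
  within_in n D `<=` (within_in p D : set (paths S)).
Proof. by move=> np w [i [ni Di]]; exists i; split=> //; exact: leq_trans np. Qed.

End path_events.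

Section probability_facts.
Local Set Implicit Arguments.
Local Unset Strict Implicit.
Context {d : measure_display} {T : measurableType d} {R : realType}.
Variable P : probability T R.
Implicit Types A B : set T.
Local Open Scope ereal_scope.

Lemma negligible_setC A : measurable A -> P A = 1 -> P.-negligible (~` A).
Proof.
move=> mA PA; apply/negligibleP; first exact: measurableC.
by apply: etrans (probability_setC P mA) _; rewrite PA subee.
Qed.

(** [A] and the complement of [B] both differ from [A] minus [B] by a null set. *)
Lemma probability_ae_setC A B : measurable A -> measurable B ->
  P.-negligible (A `&` B) -> P.-negligible (~` (A `|` B)) -> P A = 1 - P B.
Proof.
move=> mA mB nAB nC; rewrite -probability_setC//.
have mC : measurable (~` (A `|` B)) by apply: measurableC; exact: measurableU.
have mD : measurable (A `\` B) by exact: measurableD.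
have <- : P (A `\` B) = P A.
  rewrite -[in RHS](setUIDK A B) setUC measureU0//; first exact: measurableI.
  by apply/negligibleP => //; exact: measurableI.
rewrite (_ : ~` B = A `\` B `|` ~` (A `|` B)).
  by rewrite measureU0//; apply/negligibleP.
rewrite setCU setDE -setIUl setUCr setTI//.
Qed.

End probability_facts.

Section avoid_set.
Local Set Implicit Arguments.
Local Unset Strict Implicit.
Context {d : measure_display} {S : measurableType d} {R : realType}.
Variable kappa : R.-pker S ~> S.
Implicit Types (D : set S) (i k : nat).
Local Open Scope ereal_scope.

(** Fixing both times makes the event depend on finitely many coordinates. Recording the gap [k]
    instead of the second time lets a one-step shift lower [i] alone. *)
Definition avoid_then_visit D i k : set (paths S) :=
  [set w | avoid kappa D (w i) /\ D (w (i + k)%N)].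

Lemma det_sets_avoid_then_visit D i k : measurable D ->
  det_sets (avoid_then_visit D i k).
Proof.
move=> mD; split.
  apply: (@measurableI _ (paths S)).
    by have [] := det_sets_coord i (measurable_avoid kappa mD).
  by have [] := det_sets_coord (i + k) mD.
exists (i + k)%N => w w' ww' [].
by rewrite /avoid_then_visit /= !ww'// leq_addr.
Qed.

(** Links [avoid], defined by path laws, to [chain_prob], which obeys the one-step recursion. *)
Lemma path_law_dirac A s : det_sets A ->
  path_law kappa (dirac s) A = chain_prob kappa A s.
Proof.
move=> sA; rewrite path_lawE// /init_prob integral_dirac//.
  by rewrite diracT mul1e.
exact: measurable_chain_prob.
Qed.

(** The Markov property at time [i], by induction on [i]: conditioning on the first step turns the
    event for [i.+1] into the one for [i], up to conversion. *)
Lemma chain_prob_avoid_then_visit D i k s : measurable D ->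
  chain_prob kappa (avoid_then_visit D i k) s = 0.
Proof.
move=> mD; elim: i s => [|i ih] s; last first.
  rewrite chain_prob_psec; last exact: det_sets_avoid_then_visit.
  by rewrite integral0_eq.
have sE := det_sets_avoid_then_visit 0 k mD.
have [As|nAs] := pselect (avoid kappa D s).
  rewrite -path_law_dirac//; apply: subset_measure0 As.
  - by have [] := sE.
  - exact: measurable_eventually_in.
  - by move=> w [_ Dw]; exists (0 + k)%N.
(* Here [s] is outside the avoid-set, so the event already fails at time 0. *)
apply/eqP; rewrite eq_le chain_prob_ge0 andbT.
have [mC _] := det_sets_coord 0 (measurable_avoid kappa mD).
have dC : determined 0 ((fun w : paths S => w 0%N) @^-1` avoid kappa D).
  by move=> w w' /(_ 0%N (leqnn _)) /= ->.
have -> : 0 = chain_prob kappa ((fun w : paths S => w 0%N) @^-1` avoid kappa D) s.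
  by rewrite (chain_probE kappa s dC) /= indicE memNset.
apply: le_chain_prob => //; first by split => //; exists 0%N.
by move=> w [].
Qed.

Lemma negligible_visit_after_avoid (mu : probability S R) D : measurable D ->
  (path_law kappa mu).-negligible
    [set w | exists i j, [/\ (i <= j)%N, avoid kappa D (w i) & D (w j)]].
Proof.
move=> mD.
have nE i k : (path_law kappa mu).-negligible (avoid_then_visit D i k).
  have sE := det_sets_avoid_then_visit i k mD.
  apply/negligibleP; first by have [] := sE.
  apply: etrans (path_lawE kappa mu sE) _.
  by rewrite /init_prob integral0_eq// => s _; exact: chain_prob_avoid_then_visit.
apply: negligibleS (negligible_bigcup (fun i => negligible_bigcup (nE i))).
move=> w [i [j [ij Ai Dj]]]; exists i => //; exists (j - i)%N => //.
by rewrite /avoid_then_visit /= subnKC.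
Qed.

(** Continuity from below along the increasing events [within_in n D]. *)
Lemma cvg_within_in (mu : probability S R) D : measurable D ->
  fine (path_law kappa mu (within_in n D)) @[n --> \oo] -->
  fine (path_law kappa mu (eventually_in D)).
Proof.
move=> mD; have mW n : measurable (within_in n D : set (paths S)).
  by have [] := det_sets_within_in n mD.
apply: fine_cvg; rewrite fineK ?fin_num_measure//; last first.
  exact: measurable_eventually_in.
rewrite eventually_inE; apply: nondecreasing_cvg_mu => //.
  exact: bigcupT_measurable.
by move=> n p np; apply/subsetPset; exact: le_within_in.
Qed.

Lemma nondecreasing_within_in (mu : probability S R) D : measurable D ->
  nondecreasing_seq (fun n => fine (path_law kappa mu (within_in n D))).
Proof.
move=> mD n p np; have mW m : measurable (within_in m D : set (paths S)).
  by have [] := det_sets_within_in m mD.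
rewrite fine_le ?fin_num_measure// le_measure ?inE//.
exact: le_within_in.
Qed.

End avoid_set.

Theorem proposition58 (R : realType) (d : measure_display)
    (S : measurableType d) (kappa : R.-pker S ~> S) (mu : probability S R)
    (B : set S) (mB : measurable B)
    (pdecB : persistently_decisive kappa B mu)
    (dec_avoidB : decisive kappa (avoid kappa B) mu) :
  let qYes (n : nat) : R :=
    fine (path_law kappa mu (within_in n (avoid kappa (avoid kappa B)))) in
  let qNo (n : nat) : R :=
    fine (path_law kappa mu (within_in n (avoid kappa B))) in
  let pGF : R := fine (path_law kappa mu (infinitely_often_in B)) in
  [/\ adjacent_seqs qYes (fun n => 1 - qNo n),
      qYes n @[n --> \oo] --> pGF &
      1 - qNo n @[n --> \oo] --> pGF].
Proof.
move=> qYes qNo pGF.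
pose P := path_law kappa mu; pose A := avoid kappa B; pose C := avoid kappa A.
have mA : measurable A by exact: measurable_avoid.
have mC : measurable C by exact: measurable_avoid.
have mFA : measurable (eventually_in A : set (paths S)).
  exact: measurable_eventually_in.
have mFC : measurable (eventually_in C : set (paths S)).
  exact: measurable_eventually_in.
have mGF : measurable (infinitely_often_in B : set (paths S)).
  exact: measurable_infinitely_often_in.
have nB := negligible_visit_after_avoid kappa mu mB.
have nA := negligible_visit_after_avoid kappa mu mA.
(* A single null set outside which persistent decisiveness holds for all [p] at once. *)
have nAB : P.-negligible (\bigcup_p ~` (after_in p B `|` after_in p A)).
  apply: negligible_bigcup => p; apply: negligible_setC; last exact: pdecB.
  by apply: (@measurableU _ (paths S)); exact: measurable_after_in.
have PGF : (P (infinitely_often_in B) = 1 - P (eventually_in A))%E.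
  apply: probability_ae_setC => //.
    apply: negligibleS nB => w [].
    rewrite infinitely_often_inE => Bw [i Ai].
    by have [j [ij Bj]] := Bw i I; exists i, j.
  apply: negligibleS nAB => w nw; apply: contrapT => nBA; apply: nw.
  have [FA|nFA] := pselect (eventually_in A w); [by right|left].
  rewrite infinitely_often_inE => p _; apply: contrapT => nBp; apply: nBA.
  by exists p => // -[//|[i [_ Ai]]]; apply: nFA; exists i.
have PFC : (P (eventually_in C) = 1 - P (eventually_in A))%E.
  apply: probability_ae_setC => //; last first.
    apply: negligible_setC; first exact: (@measurableU _ (paths S)).
    by rewrite setUC; exact: dec_avoidB.
  (* Let the path be in [C] at time [j] and in [A] at time [i]. The three null sets cover the cases:
     [A] is visited from [j] on; otherwise [B] is; neither is. *)
  apply: negligibleS (negligibleU (negligibleU nA nB) nAB).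
  move=> w [[j Cj] [i Ai]].
  have [jA|njA] := pselect (after_in j A w).
    by left; left; case: jA => k [jk Ak]; exists j, k.
  have [jB|njB] := pselect (after_in j B w).
    left; right; case: jB => k [jk Bk]; exists i, k; split => //.
    (* If [i] exceeded [k], then [j <= k < i] would make [i] a visit to [A] after [j]. *)
    rewrite leqNgt; apply/negP => ki; apply: njA.
    by exists i; split => //; exact: leq_trans jk (ltnW ki).
  by right; exists j => // -[].
have pE : pGF = 1 - fine (P (eventually_in A)).
  by rewrite /pGF PGF fineB ?fin_num_measure.
have cYes : qYes n @[n --> \oo] --> pGF.
  (* The limit of [qYes] is the probability of eventually reaching [C], which equals that of
     visiting [B] infinitely often. *)
  by rewrite /pGF PGF -PFC; exact: cvg_within_in.
have cNo : 1 - qNo n @[n --> \oo] --> pGF.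
  by rewrite pE; apply: cvgB; [exact: cvg_cst|exact: cvg_within_in].
split => //; split; last by rewrite -(subrr pGF); exact: cvgB.
left; split; first exact: nondecreasing_within_in.
by move=> n p np; rewrite lerD2l lerN2; exact: nondecreasing_within_in.
Qed.
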